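(* (PVH Criterion.) If $\pi^{Syz}_p$ is surjective for all $p\ge 2$, then $K$ is quadratic, i.e. the natural surjection $A^m\to I_K^m/I_K^{m+1}$ is an isomorphism for all $m$. If moreover $X$ is finite and $A$ is Koszul, then it suffices that $\pi^{Syz}_p$ be surjective for $p=2$ and $p=3$.
   Context: Let $K$ be an augmented unital $\mathbb{Q}$-algebra generated by a set $X$, $F$ the free unital $\mathbb{Q}$-algebra on $X$, and $I_F\subseteq F$, $I_K\subseteq K$ the kernels of the algebra maps sending each $x\in X$ to $1$. Let $\tilde X=\mathbb{Q}\{x-1:x\in X\}$, so $F=T\tilde X=\bigoplus_p\tilde X^p$ and $I_F^p=\bigoplus_{q\ge p}\tilde X^q$. Let $M\subseteq I_F$ be a two-sided ideal with $K=F/M$. $K$ and $F$ are replaced by their completions with respect to powers of their augmentation ideals, and $M\subseteq I_F^2$ is assumed. Let $\{y_q:q\in Q\}\subseteq I_F^2$ generate $M$ as a two-sided ideal, $Y_F=\{Y_q\}$ symbols in bijection with them, $R$ the free two-sided $F$-module on $Y_F$, and $\partial_K:R\to F$ the bimodule map $Y_q\mapsto y_q$. Grade $R$ by $R_p=\sum_{q=0}^{p-2}\tilde X^q\cdot\mathbb{Q}Y_F\cdot\tilde X^{p-q-2}$ and set $R_{\ge p}=\bigoplus_{q\ge p}R_q$. Let $\pi^0_p:I_F^p\to\tilde X^p$, $\pi^1_p:R_{\ge p}\to R_p$ be the degree-$p$ projections, $\partial_A=\pi^0_p\circ\partial_K:R_p\to\tilde X^p$, and $A=\bigoplus_p\tilde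 X^p/\bigoplus_p\partial_A(R_p)$ with graded pieces $A^p$ (this is the quadratic approximation of $\operatorname{gr}K=\bigoplus_m I_K^m/I_K^{m+1}$, and there is a natural surjection $A^m\to I_K^m/I_K^{m+1}$ induced by $\tilde X^m\cong I_F^m/I_F^{m+1}\to I_K^m/I_K^{m+1}$). $\pi^{Syz}_p:\ker(\partial_K|_{R_{\ge p}})\to\ker(\partial_A|_{R_p})$ is the map induced by $\pi^1_p$. $K$ is called quadratic if $A^m\to I_K^m/I_K^{m+1}$ is an isomorphism for all $m$. *)

(* Defs.v *)
From HB Require Import structures.
From mathcomp Require Import all_boot all_order all_algebra.
From mathcomp Require Import finmap.
From Stdlib Require List.
Set Implicit Arguments. Unset Strict Implicit. Unset Printing Implicit Defensive.
Import Order.TTheory GRing.Theory Num.Theory.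
Local Open Scope fset_scope.
Local Open Scope ring_scope.

(* Conventions.
   - X (generators) and Qi (index set of the relators y_q) are choiceTypes.
   - A word w : seq X stands for the monomial (x_1 - 1)...(x_k - 1), so
     X~^k has basis the words of length k.  An element of the completed free
     algebra F = prod_p X~^p is a function  f : seq X -> rat  with finitely
     many nonzero coefficients in each degree (predicate [Fser]).
   - A term (u, q, v) stands for the bimodule generator u Y_q v of R;
     it has degree |u| + |v| + 2.  An element of R_p is a finitely supported
     function on terms of degree p; an element of the completed bimodule R
     is a sequence r : nat -> Rhom with r p in R_p (predicate [Rser]). *)

Section Defs.
Variables (X Qi : choiceType).

Definition term := (seq X * Qi * seq X)%type.
Definition Rhom := {fsfun term -> rat with 0}.

Definition rdeg (t : term) : nat := (size t.1.1 + size t.2 + 2)%N.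

Definition homR (p : nat) (s : Rhom) : Prop :=
  forall t, t \in finsupp s -> rdeg t = p.

Definition Rser (r : nat -> Rhom) : Prop := forall p, homR p (r p).

Definition homF (n : nat) (f : seq X -> rat) : Prop :=
  forall w, size w != n -> f w = 0.

Definition Fser (f : seq X -> rat) : Prop :=
  forall p, exists s : seq (seq X), forall w, size w = p -> f w != 0 -> w \in s.

Definition finsuppF (f : seq X -> rat) : Prop :=
  exists s : seq (seq X), forall w, f w != 0 -> w \in s.

(* coefficient of the word w in u * y_q * v *)
Definition apply_term (y : Qi -> seq X -> rat) (t : term) (w : seq X) : rat :=
  let: (u, q, v) := t in
  if ((size u + size v <= size w)%N && (take (size u) w == u)
      && (drop (size w - size v) w == v))
  then y q (drop (size u) (take (size w - size v) w)) else 0.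

(* the bimodule map d_K : Y_q |-> y_q, on a homogeneous element *)
Definition dKhom (y : Qi -> seq X -> rat) (s : Rhom) (w : seq X) : rat :=
  \sum_(t <- finsupp s) s t * apply_term y t w.

(* d_K on the completed bimodule; only components of degree <= |w| + 2 can
   contribute to the coefficient of w, so the sum is finite. *)
Definition dK (y : Qi -> seq X -> rat) (r : nat -> Rhom) (w : seq X) : rat :=
  \sum_(p < (size w + 3)%N) dKhom y (r p) w.

(* f (in X~^m) lies in d_A(R_m), where d_A = pi^0_m o d_K on R_m *)
Definition in_dA (y : Qi -> seq X -> rat) (m : nat) (f : seq X -> rat) : Prop :=
  homF m f /\
  exists s : Rhom, homR m s /\ forall w, size w = m -> dKhom y s w = f w.

(* f (in X~^m) maps to 0 in I_K^m / I_K^{m+1}, i.e. f in M + I_F^{m+1},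
   where M = d_K(R) is the (closed) two-sided ideal generated by the y_q. *)
Definition in_M_plus_I (y : Qi -> seq X -> rat) (m : nat) (f : seq X -> rat) : Prop :=
  exists r, Rser r /\ forall w, (size w <= m)%N -> f w = dK y r w.

(* K is quadratic: for every m the kernel of the natural surjection
   X~^m -> I_K^m/I_K^{m+1} is exactly d_A(R_m), i.e. the induced
   surjection A^m -> I_K^m/I_K^{m+1} is an isomorphism. *)
Definition quadratic (y : Qi -> seq X -> rat) : Prop :=
  forall (m : nat) (f : seq X -> rat), homF m f -> finsuppF f ->
    (in_M_plus_I y m f <-> in_dA y m f).

(* pi^Syz_p : ker(d_K | R_{>=p}) -> ker(d_A | R_p) is surjective *)
Definition piSyz_surj (y : Qi -> seq X -> rat) (p : nat) : Prop :=
  forall s : Rhom, homR p s -> (forall w, size w = p -> dKhom y s w = 0) ->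
    exists r : nat -> Rhom,
      [/\ Rser r, (forall p' t, (p' < p)%N -> r p' t = 0),
          (forall w, dK y r w = 0) & (forall t, r p t = s t)].

Definition tensF (a b : nat) (u w : seq X -> rat) : seq X -> rat :=
  fun x => if size x == (a + b)%N then u (take a x) * w (drop a x) else 0.

Definition tens (a b : nat) (U W : (seq X -> rat) -> Prop) (f : seq X -> rat) : Prop :=
  exists l : seq (rat * (seq X -> rat) * (seq X -> rat)),
    List.Forall (fun t => U t.1.2 /\ W t.2) l /\
    forall x, f x = \sum_(t <- l) t.1.1 * tensF a b t.1.2 t.2 x.

Definition sumS (U W : (seq X -> rat) -> Prop) (f : seq X -> rat) : Prop :=
  exists u w, [/\ U u, W w & forall x, f x = u x + w x].

(* K_n = intersection over i + j = n - 2 of X~^i (x) d_A(R_2) (x) X~^j,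
   (K_0 = X~^0, K_1 = X~^1), the dual of A^!_n *)
Definition Kz (y : Qi -> seq X -> rat) (n : nat) (f : seq X -> rat) : Prop :=
  homF n f /\
  forall i, (i + 2 <= n)%N ->
    tens i (n - i) (homF i) (tens 2 (n - i - 2) (in_dA y 2) (homF (n - i - 2))) f.

(* The Koszul complex ... -> A (x) K_n -> A (x) K_(n-1) -> ... -> A -> Q -> 0,
   a (x) v1...vn |-> a v1 (x) v2...vn.  In internal degree d its n-th term is
   A^(d-n) (x) K_n = P_n / Q_n with P_n = X~^(d-n) (x) K_n and
   Q_n = d_A(R_(d-n)) (x) K_n (subspaces of X~^d), the differential being
   induced by the inclusion P_n <= P_(n-1).  Exactness at the n-th term means
   ker = im, i.e.  P_n /\ Q_(n-1) = P_(n+1) + Q_n.  (Exactness at n = 0 and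
   n = d and in degree 0 holds automatically.) *)
Definition Kpos (y : Qi -> seq X -> rat) (d n : nat) := tens (d - n) n (homF (d - n)) (Kz y n).
Definition Kneg (y : Qi -> seq X -> rat) (d n : nat) := tens (d - n) n (in_dA y (d - n)) (Kz y n).

Definition Koszul (y : Qi -> seq X -> rat) : Prop :=
  forall d n : nat, (0 < n)%N -> (n < d)%N ->
    forall f, (Kpos y d n f /\ Kneg y d n.-1 f) <->
              sumS (Kpos y d n.+1) (Kneg y d n) f.

End Defs.

(* Main.v *)
(* If every homogeneous syzygy of the leading parts lifts to a syzygy of the y_q,
   an element of M + I_F^{m+1} can be written as d_K r with r of lowest degree m:
   the components of r below m have leading part killed by d_A, so they can be
   removed one degree at a time by subtracting lifts.  This gives the first claim.

   For the second claim let S = d_A(R_2), V = X~, and let s in R_p be a syzygy of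
   d_A whose terms u Y_q v all satisfy |u| <= k + 1.  The part of s with |u| = k + 1
   maps to (V^{k+1} S) /\ (I_{k+2} V), tensored on the right with a power of V,
   where I is the kernel of T V -> A.  Exactness of the Koszul complex at its second term
   says that this is V^k K_3 + I_{k+1} S.  Elements of V^k K_3 come from syzygies
   of degree 3, and elements of I_{k+1} S from the trivial syzygies
   d(r) r' - r d(r'), which always lift.  Up to liftable syzygies, including those
   of degree 2, s can therefore be rewritten with |u| <= k. *)
Require Import Defs.
From HB Require Import structures.
From mathcomp Require Import all_boot all_order all_algebra.
From mathcomp Require Import finmap zify.
From mathcomp.multinomials Require Import monalg.
Set Implicit Arguments. Unset Strict Implicit. Unset Printing Implicit Defensive.
Import GRing.Theory.
Local Open Scope ring_scope.

(** * Linear maps out of a free module *)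

Section LinearExtension.
Variables (T : choiceType) (V : lmodType rat).
Implicit Types (F : T -> V) (s : {malg rat[T]}).

Definition lext F s : V := \sum_(t <- msupp s) s@_t *: F t.

Lemma lextEw F s (A : {fset T}) : {subset msupp s <= A} ->
  lext F s = \sum_(t <- A) s@_t *: F t.
Proof.
move=> /fsubsetP sA; rewrite /lext; apply: big_fset_incl => // t _ tNs.
by rewrite mcoeff_outdom // scale0r.
Qed.

Lemma lext_linear F : linear (lext F).
Proof.
move=> c s1 s2; pose A := (msupp (c *: s1 + s2) `|` (msupp s1 `|` msupp s2))%fset.
have sub0 : {subset msupp (c *: s1 + s2) <= A}.
  by move=> t ts; rewrite in_fsetU ts.
have sub1 : {subset msupp s1 <= A} by move=> t ts; rewrite !in_fsetU ts orbT.
have sub2 : {subset msupp s2 <= A} by move=> t ts; rewrite !in_fsetU ts !orbT.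
rewrite (lextEw _ sub0) (lextEw _ sub1) (lextEw _ sub2).
rewrite scaler_sumr -big_split /=; apply: eq_bigr => t _.
by rewrite mcoeffD mcoeffZ scalerDl scalerA.
Qed.

HB.instance Definition _ F :=
  GRing.isLinear.Build rat {malg rat[T]} V *:%R (lext F) (lext_linear F).

Lemma lextU F t : lext F << t >> = F t.
Proof.
rewrite (@lextEw _ _ [fset t]%fset); last by move=> u; rewrite msuppU oner_eq0.
by rewrite big_seq_fset1 mcoeffU eqxx scale1r.
Qed.

End LinearExtension.

(** * Elements supported on a set of basis terms *)

Section Supported.
Variable T : choiceType.
Implicit Types (P : pred T) (s : {malg rat[T]}).

Definition supported P s := forall t, s@_t != 0 -> P t.

Lemma supported0 P : supported P 0.
Proof. by move=> t; rewrite mcoeff0 eqxx. Qed.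

Lemma supportedD P s1 s2 : supported P s1 -> supported P s2 -> supported P (s1 + s2).
Proof.
move=> H1 H2 t; rewrite mcoeffD => nz.
have [/eqP z|] := boolP (s1@_t == 0); last exact: H1.
by apply: H2; rewrite z add0r in nz.
Qed.

Lemma supportedZ P c s : supported P s -> supported P (c *: s).
Proof. by move=> H t; rewrite mcoeffZ mulf_eq0 negb_or => /andP[_ /H]. Qed.

Lemma supportedB P s1 s2 : supported P s1 -> supported P s2 -> supported P (s1 - s2).
Proof. by move=> H1 H2; rewrite -scaleN1r; apply/supportedD/supportedZ. Qed.

Lemma supported_sum P (I : Type) (r : seq I) (Q : pred I) (F : I -> {malg rat[T]}) :
  (forall i, Q i -> supported P (F i)) -> supported P (\sum_(i <- r | Q i) F i).
Proof.
by move=> H; elim/big_ind: _ => //; [exact: supported0 | exact: supportedD].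
Qed.

Lemma supportedU P t : P t -> supported P << t >>.
Proof. by move=> Pt u; rewrite mcoeffU; case: (t =P u) => [<-|]; rewrite ?eqxx. Qed.

Lemma supported_sub P (Q : pred T) s : (forall t, P t -> Q t) -> supported P s -> supported Q s.
Proof. by move=> PQ Ps t /Ps/PQ. Qed.

Lemma supported_eq0 s : supported pred0 s -> s = 0.
Proof. by move=> H; apply/malgP => t; rewrite mcoeff0; apply/eqP/negPn/negP => /H. Qed.

Lemma malg_lext s : s = lext (fun t => << t >>) s.
Proof.
rewrite {1}(monalgE s); apply: eq_bigr => t _; apply/malgP => u.
by rewrite mcoeffZ !mcoeffU mulrnAr mulr1.
Qed.

Lemma eq_lext P (V : lmodType rat) (f g : {linear {malg rat[T]} -> V}) s :
  supported P s -> (forall t, P t -> f << t >> = g << t >>) -> f s = g s.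
Proof.
move=> Ps fg; rewrite (malg_lext s) /lext !linear_sum !big_seq.
apply: eq_bigr => t; rewrite -mcoeff_neq0 => /Ps/fg E; by rewrite !linearZ /= E.
Qed.

End Supported.

Lemma malg_sum_linear (T : choiceType) (P : pred T) (I : Type) (r : seq I)
    (f : I -> {linear {malg rat[T]} -> {malg rat[T]}}) s :
  supported P s -> (forall t, P t -> << t >> = \sum_(i <- r) f i << t >>) ->
  s = \sum_(i <- r) f i s.
Proof.
move=> Ps fE; rewrite {1}(malg_lext s) {1}/lext.
transitivity (\sum_(i <- r) \sum_(t <- msupp s) s@_t *: f i << t >>); last first.
  apply: eq_bigr => i _; rewrite {3}(malg_lext s) linear_sum.
  by apply: eq_bigr => t _; rewrite linearZ.
rewrite exchange_big /= !big_seq; apply: eq_bigr => t.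
rewrite -mcoeff_neq0 => /Ps/fE E.
by rewrite {1}E scaler_sumr.
Qed.

Lemma lext_supported (T T' : choiceType) (P : pred T) (Q : pred T') (F : T' -> {malg rat[T]})
    (s : {malg rat[T']}) :
  supported Q s -> (forall t, Q t -> supported P (F t)) -> supported P (lext F s).
Proof.
move=> Qs QP; rewrite /lext big_seq; apply: supported_sum => t.
by rewrite -mcoeff_neq0 => /Qs/QP; exact: supportedZ.
Qed.

(** * The bimodule of relators *)

Section Bimodule.
Variables (X Qi : choiceType) (y : Qi -> seq X -> rat).
Hypothesis hy2 : forall q w, (size w < 2)%N -> y q w = 0.

Local Notation term := (term X Qi).
Local Notation RM := {malg rat[term]}.
Implicit Types (t : term) (s : RM) (u v w z : seq X) (p : nat).

(** Each [y q] starts in degree 2, which is the 2 added in [rdeg]; hence only finitely many degrees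
    of R reach a given coefficient. *)
Lemma apply_term_low t w : (size w < rdeg t)%N -> apply_term y t w = 0.
Proof.
case: t => [[u q] v]; rewrite /apply_term /rdeg /= => lt_w.
case: ifP => // /andP[/andP[le_w _] _]; apply: hy2.
rewrite size_drop size_takel ?leq_subr //; lia.
Qed.

Lemma apply_term_catl u a q v w :
  apply_term y (u ++ a, q, v) w =
    if take (size u) w == u then apply_term y (a, q, v) (drop (size u) w) else 0.
Proof.
rewrite /apply_term size_cat; case: (take _ w =P u) => [tw|tw]; last first.
  case: ifP => // /andP[/andP[le_w /eqP E] _]; case: tw.
  rewrite -[RHS](take_size_cat a (erefl (size u))) -E take_takel //; exact: leq_addr.
have [b ->] : exists b, w = u ++ b by exists (drop (size u) w); rewrite -{1}tw cat_take_drop.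
rewrite (drop_size_cat b (erefl (size u))).
rewrite size_cat -addnA leq_add2l.
case: (leqP (size a + size v) (size b)) => // le_b.
have -> : (size u + size b - size v = size u + (size b - size v))%N by lia.
have dropu n x : drop (size u + n) (u ++ x) = drop n x.
  by rewrite addnC -drop_drop drop_size_cat.
have takeu n x : take (size u + n) (u ++ x) = u ++ take n x.
  by rewrite takeD take_size_cat // drop_size_cat.
by rewrite !(takeu, dropu) eqseq_cat ?eqxx.
Qed.

Lemma apply_term_catr a q v z w :
  apply_term y (a, q, v ++ z) w =
    if drop (size w - size z) w == z
    then apply_term y (a, q, v) (take (size w - size z) w) else 0.
Proof.
rewrite /apply_term size_cat; case: (drop _ w =P z) => [dw|dw]; last first.
  case: ifP => // /andP[/andP[le_w _] /eqP E]; case: dw.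
  have -> : (size w - size z = size v + (size w - (size v + size z)))%N by lia.
  by rewrite -drop_drop E drop_size_cat.
have [b ->] : exists b, w = b ++ z.
  by exists (take (size w - size z) w); rewrite -{2}dw cat_take_drop.
rewrite size_cat addnK (take_size_cat z (erefl (size b))).
rewrite addnA leq_add2r.
case: (leqP (size a + size v) (size b)) => //= le_b.
have -> : (size b + size z - (size v + size z) = size b - size v)%N by lia.
have dropl n : (n <= size b)%N -> drop n (b ++ z) = drop n b ++ z.
  by move=> le_n; rewrite -{1}[b](cat_take_drop n) -catA drop_size_cat ?size_takel.
rewrite dropl ?leq_subr // !takel_cat ?leq_subr ?(leq_trans (leq_addr _ _) le_b) //.
by rewrite eqseq_cat ?eqxx ?andbT ?le_b // size_drop subKn // (leq_trans (leq_addl _ _) le_b).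
Qed.

Local Arguments apply_term : simpl never.

(* [der w s] is the coefficient of the word w in d_K s; [rat^o] makes it a linear map. *)
Definition der w : RM -> rat^o := lext (fun t => apply_term y t w : rat^o).
HB.instance Definition _ w := GRing.Linear.on (der w).

Definition lmul u : RM -> RM := lext (fun t => << (u ++ t.1.1, t.1.2, t.2) >>).
HB.instance Definition _ u := GRing.Linear.on (lmul u).

Definition rmul v : RM -> RM := lext (fun t => << (t.1.1, t.1.2, t.2 ++ v) >>).
HB.instance Definition _ v := GRing.Linear.on (rmul v).

Definition lslice u : RM -> RM := lext (fun t =>
  if take (size u) t.1.1 == u then << (drop (size u) t.1.1, t.1.2, t.2) >> else 0).
HB.instance Definition _ u := GRing.Linear.on (lslice u).

Definition rslice v : RM -> RM := lext (fun t =>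
  if drop (size t.2 - size v) t.2 == v
  then << (t.1.1, t.1.2, take (size t.2 - size v) t.2) >> else 0).
HB.instance Definition _ v := GRing.Linear.on (rslice v).

Lemma derB w s1 s2 : der w (s1 - s2) = der w s1 - der w s2.
Proof. exact: linearB. Qed.

Lemma der_lmul u s w :
  der w (lmul u s) = if take (size u) w == u then der (drop (size u) w) s else 0.
Proof.
case: ifP => uw.
  apply: (@eq_lext _ predT _ (der w \o lmul u) (der (drop (size u) w))) => // -[[a q] v] _.
  by rewrite /= /lmul /der !lextU apply_term_catl uw.
apply: (@eq_lext _ predT _ (der w \o lmul u) \0) => // -[[a q] v] _.
by rewrite /= /lmul /der !lextU apply_term_catl uw.
Qed.

Lemma der_rmul v s w :
  der w (rmul v s) =
    if drop (size w - size v) w == v then der (take (size w - size v) w) s else 0.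
Proof.
case: ifP => vw.
  apply: (@eq_lext _ predT _ (der w \o rmul v) (der (take (size w - size v) w))) => //.
  by move=> -[[a q] z] _; rewrite /= /rmul /der !lextU apply_term_catr vw.
apply: (@eq_lext _ predT _ (der w \o rmul v) \0) => // -[[a q] z] _.
by rewrite /= /rmul /der !lextU apply_term_catr vw.
Qed.

Lemma der_low p s w : supported (fun t => rdeg t == p) s -> (size w < p)%N -> der w s = 0.
Proof.
move=> Hs lt_w; apply: (@eq_lext _ (fun t => rdeg t == p) _ (der w) \0) => // t /eqP dt.
by rewrite /= /der lextU apply_term_low // dt.
Qed.

(** When no left factor is shorter than u, a term reaches a word beginning with u only if its own
    left factor begins with u. Slices of a syzygy are therefore syzygies. *)
Lemma der_lslice u s w : supported (fun t => size u <= size t.1.1)%N s ->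
  der (u ++ w) s = der w (lslice u s).
Proof.
move=> Hs; apply: (eq_lext (f := der (u ++ w)) (g := der w \o lslice u) Hs).
move=> -[[a q] v] /= le_u; rewrite /lslice /der !lextU /=.
rewrite -{1}[a](cat_take_drop (size u)) apply_term_catl size_takel //.
rewrite take_size_cat // drop_size_cat // eq_sym.
by case: ifP => _; rewrite ?lextU // linear0.
Qed.

Lemma der_rslice z s w : supported (fun t => size z <= size t.2)%N s ->
  der (w ++ z) s = der w (rslice z s).
Proof.
move=> Hs; apply: (eq_lext (f := der (w ++ z)) (g := der w \o rslice z) Hs).
move=> -[[a q] v] /= le_z; rewrite /rslice /der !lextU /=.
rewrite -{1}[v](cat_take_drop (size v - size z)) apply_term_catr size_drop subKn //.
rewrite size_cat addnK take_size_cat // drop_size_cat // eq_sym.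
by case: ifP => _; rewrite ?lextU // linear0.
Qed.

(** * Lifting syzygies *)

Definition dser (r : nat -> RM) w : rat := \sum_(n < (size w + 3)%N) der w (r n).

Definition graded (r : nat -> RM) := forall n, supported (fun t => rdeg t == n) (r n).

(** Membership in the image of pi^Syz_p. *)
Definition liftable p s := exists r : nat -> RM,
  [/\ graded r, (forall n, (n < p)%N -> r n = 0), (forall w, dser r w = 0) & r p = s].

(** Components of degree above [size w] contribute nothing, so the cut-off can be chosen to suit
    each computation. *)
Lemma dserE r w N : graded r -> (size w < N)%N -> dser r w = \sum_(n < N) der w (r n).
Proof.
move=> gr; suff dN M : (size w < M)%N ->
    \sum_(n < M) der w (r n) = \sum_(n < (size w).+1) der w (r n).
  by move=> lt_w; rewrite /dser !dN //; lia.
move=> lt_w; rewrite -!(big_mkord predT (fun n => der w (r n))).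
rewrite (big_cat_nat (n := (size w).+1)) //= [X in _ + X]big_nat [X in _ + X]big1 ?addr0 //.
by move=> n /andP[lt_n _]; apply: der_low (gr n) _.
Qed.

Lemma dser_lowest r p w : graded r -> (forall n, (n < p)%N -> r n = 0) ->
  (size w <= p)%N -> dser r w = der w (r p).
Proof.
move=> gr r0 le_w; rewrite (dserE (N := p.+1)) // big_ord_recr /= big1 ?add0r //.
by move=> n _; rewrite r0 ?linear0.
Qed.

Lemma liftable_der p s w : liftable p s -> size w = p -> der w s = 0.
Proof.
by case=> r [gr r0 rK <-] sw; rewrite -(dser_lowest gr r0) ?sw.
Qed.

Lemma dser_lin c r1 r2 w : dser (fun n => c *: r1 n + r2 n) w = c * dser r1 w + dser r2 w.
Proof.
by rewrite /dser mulr_sumr -big_split; apply: eq_bigr => n _; rewrite linearP.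
Qed.

Lemma graded_lin c r1 r2 : graded r1 -> graded r2 -> graded (fun n => c *: r1 n + r2 n).
Proof. by move=> g1 g2 n; apply: supportedD => //; apply: supportedZ. Qed.

Lemma liftable0 p : liftable p 0.
Proof.
exists (fun _ => 0); split=> // [n|w]; first exact: supported0.
by rewrite /dser big1 // => n _; rewrite linear0.
Qed.

Lemma liftable_lin p c s1 s2 : liftable p s1 -> liftable p s2 -> liftable p (c *: s1 + s2).
Proof.
move=> [r1 [g1 z1 k1 <-]] [r2 [g2 z2 k2 <-]]; exists (fun n => c *: r1 n + r2 n).
split=> // [|n lt_n|w]; first exact: graded_lin.
  by rewrite z1 // z2 // scaler0 addr0.
by rewrite dser_lin k1 k2 mulr0 addr0.
Qed.

Lemma liftableD p s1 s2 : liftable p s1 -> liftable p s2 -> liftable p (s1 + s2).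
Proof. by move=> H1 H2; rewrite -[s1]scale1r; apply: liftable_lin. Qed.

Lemma liftableZ p c s : liftable p s -> liftable p (c *: s).
Proof. by move=> H; rewrite -[_ *: _]addr0; apply: liftable_lin => //; apply: liftable0. Qed.

Lemma liftable_sum p (I : Type) (r : seq I) (P : pred I) (F : I -> RM) :
  (forall i, P i -> liftable p (F i)) -> liftable p (\sum_(i <- r | P i) F i).
Proof. by move=> H; elim/big_ind: _ => //; [exact: liftable0 | exact: liftableD]. Qed.

Lemma supported_lmul (P Q : pred term) u s : supported P s ->
  (forall t, P t -> Q (u ++ t.1.1, t.1.2, t.2)) -> supported Q (lmul u s).
Proof. by move=> Ps PQ; apply: lext_supported Ps _ => t /PQ; apply: supportedU. Qed.

Lemma supported_rmul (P Q : pred term) v s : supported P s ->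
  (forall t, P t -> Q (t.1.1, t.1.2, t.2 ++ v)) -> supported Q (rmul v s).
Proof. by move=> Ps PQ; apply: lext_supported Ps _ => t /PQ; apply: supportedU. Qed.

Lemma supported_lslice (P Q : pred term) u s : supported P s ->
  (forall t, P (u ++ t.1.1, t.1.2, t.2) -> Q t) -> supported Q (lslice u s).
Proof.
move=> Ps PQ; apply: lext_supported Ps _ => -[[a q] v] Pt /=.
case: eqP => [ua|_]; last exact: supported0.
by apply/supportedU/PQ; rewrite /= -{1}ua cat_take_drop.
Qed.

Lemma supported_rslice (P Q : pred term) z s : supported P s ->
  (forall t, P (t.1.1, t.1.2, t.2 ++ z) -> Q t) -> supported Q (rslice z s).
Proof.
move=> Ps PQ; apply: lext_supported Ps _ => -[[a q] v] Pt /=.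
case: eqP => [zv|_]; last exact: supported0.
by apply/supportedU/PQ; rewrite /= -{2}zv cat_take_drop.
Qed.

(** Since d_K is a bimodule map, multiplying a lift by u, with degrees shifted by [size u], gives a
    lift. *)
Lemma liftable_lmul p u s : liftable p s -> liftable (size u + p) (lmul u s).
Proof.
move=> [r [gr r0 rK <-]].
exists (fun n => if (size u <= n)%N then lmul u (r (n - size u)%N) else 0).
have gr' : graded (fun n => if (size u <= n)%N then lmul u (r (n - size u)%N) else 0).
  move=> n; case: leqP => le_n; last exact: supported0.
  apply: supported_lmul (gr _) _ => -[[a q] v] /=; rewrite /rdeg /= size_cat; lia.
split=> // [n lt_n|w|]; last by rewrite leq_addr addKn.
  by case: leqP => // le_n; rewrite r0 ?linear0 //; lia.
(* This cut-off is larger than needed, so that the sum splits at [size u], where the shifted lift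
   begins. *)
rewrite (dserE (N := (size u + (size w).+1)%N)) //; last by lia.
rewrite big_split_ord /= big1 ?add0r; last first.
  by move=> i _; rewrite leqNgt ltn_ord linear0.
under eq_bigr => i _ do rewrite leq_addr addKn der_lmul.
case: eqP => uw; last by rewrite big1.
by rewrite -dserE ?rK // size_drop; lia.
Qed.

Lemma liftable_rmul p v s : liftable p s -> liftable (p + size v) (rmul v s).
Proof.
move=> [r [gr r0 rK <-]]; rewrite addnC.
exists (fun n => if (size v <= n)%N then rmul v (r (n - size v)%N) else 0).
have gr' : graded (fun n => if (size v <= n)%N then rmul v (r (n - size v)%N) else 0).
  move=> n; case: leqP => le_n; last exact: supported0.
  apply: supported_rmul (gr _) _ => -[[a q] z] /=; rewrite /rdeg /= size_cat; lia.
split=> // [n lt_n|w|]; last by rewrite leq_addr addKn.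
  by case: leqP => // le_n; rewrite r0 ?linear0 //; lia.
rewrite (dserE (N := (size v + (size w).+1)%N)) //; last by lia.
rewrite big_split_ord /= big1 ?add0r; last first.
  by move=> i _; rewrite leqNgt ltn_ord linear0.
under eq_bigr => i _ do rewrite leq_addr addKn der_rmul.
case: eqP => vw; last by rewrite big1.
by rewrite -dserE ?rK // ltnS size_takel leq_subr.
Qed.

(** * From liftable syzygies to quadraticity *)

Lemma dKhomE (s : Rhom X Qi) w : dKhom y s w = der w (mkmalg s).
Proof. by []. Qed.

Lemma homRP p (s : RM) : supported (fun t => rdeg t == p) s <-> homR p (malg_val s).
Proof.
split=> H t; first by move=> ts; apply/eqP/H; rewrite mcoeff_neq0.
by rewrite mcoeff_neq0 => /H ->.
Qed.

Lemma homR_supported p (s : Rhom X Qi) :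
  homR p s -> supported (fun t => rdeg t == p) (mkmalg s).
Proof. by move=> Hs; apply/homRP. Qed.

Lemma piSyz_liftable p s : piSyz_surj y p -> supported (fun t => rdeg t == p) s ->
  (forall w, size w = p -> der w s = 0) -> liftable p s.
Proof.
move=> sur /homRP Hs s0; have [r [Rr r0 rK rp]] := sur _ Hs s0.
exists (fun n => mkmalg (r n)); split=> [n|n lt_n|w|].
- exact/homRP.
- by apply/malgP => t; rewrite mcoeff0 -(r0 n t lt_n).
- exact: rK.
by apply/malgP => t; exact: rp.
Qed.

Lemma quadratic_of_liftable :
  (forall p s, supported (fun t => rdeg t == p) s ->
    (forall w, size w = p -> der w s = 0) -> liftable p s) -> quadratic y.
Proof.
move=> lft m f fm _; split=> [[r [Rr fE]]|[_ [s [sm sE]]]]; last first.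
  (* The inclusion that always holds: a preimage of f under d_A, placed alone in degree m, has the
     right image up to degree m, as both sides vanish below m. *)
  exists (fun n => malg_val (if n == m then mkmalg s else 0)).
  have gr : graded (fun n => if n == m then mkmalg s else 0).
    by move=> n; case: eqP => [->|_]; [apply/homRP | apply: supported0].
  split=> [n|w le_w]; first by apply/homRP; apply: gr.
  (* [dK] and [dser] agree by conversion: [malg] only wraps finitely supported functions, and
     scaling in [rat^o] is multiplication. *)
  change (f w = dser (fun n => if n == m then mkmalg s else 0) w).
  rewrite (dser_lowest (p := m)) // ?eqxx; last first.
    by move=> n lt_n; rewrite ltn_eqF.
  have [/sE <- //|ne] := eqVneq (size w) m.
  rewrite fm // (der_low (p := m)) //; first exact/homRP.
  by rewrite ltn_neqAle ne.
have [r' [gr r'0 r'E]] : exists r' : nat -> RM,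
    [/\ graded r', forall n, (n < m)%N -> r' n = 0 &
        forall w, (size w <= m)%N -> f w = dser r' w].
  suff kill k : (k <= m)%N -> exists r' : nat -> RM,
      [/\ graded r', forall n, (n < k)%N -> r' n = 0 &
          forall w, (size w <= m)%N -> f w = dser r' w] by exact: kill.
  elim: k => [|k IH] lt_k.
    by exists (fun n => mkmalg (r n)); split=> [n||w] //; [apply/homRP | apply: fE].
  have [r1 [g1 z1 E1]] := IH (ltnW lt_k).
  (* As k < m, f vanishes in degree k, so the lowest component [r1 k] is a syzygy of leading parts;
     subtracting its lift clears degree k. *)
  have [|r2 [g2 z2 k2 e2]] := lft k (r1 k) (g1 k).
    move=> w sw; rewrite -(dser_lowest g1 z1) ?sw // -E1 ?sw ?(ltnW lt_k) //.
    by apply: fm; rewrite sw ltn_eqF.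
  exists (fun n => (-1) *: r2 n + r1 n); split=> [|n|w le_w]; first exact: graded_lin.
    rewrite ltnS leq_eqVlt => /orP[/eqP ->|lt_n]; first by rewrite e2 scaleN1r addNr.
    by rewrite z1 // z2 // scaler0 addr0.
  by rewrite dser_lin k2 mulr0 add0r E1.
split=> //; exists (malg_val (r' m)); split; first by apply/homRP; apply: gr.
by move=> w sw; rewrite r'E ?sw // (dser_lowest gr r'0) ?sw.
Qed.

(** * Finite alphabets *)

Section FiniteAlphabet.
Variable (l : seq X).
Hypothesis hl : forall x, x \in l.

(** The list l may repeat letters; [undup] makes each word occur once, so that sums over words are
    sums over a basis. *)
Fixpoint words n : seq (seq X) :=
  if n is m.+1 then [seq x :: w | x <- undup l, w <- words m] else [:: [::]].

Lemma mem_words n w : (w \in words n) = (size w == n).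
Proof.
elim: n w => [|n IH] [|x w] //=.
  by apply/allpairsP => -[[a b] []].
rewrite eqSS -IH; apply/allpairsP/idP => [[[a b] /= [_ + [_ ->]]] //|wn].
by exists (x, w); rewrite mem_undup hl.
Qed.

Lemma words_uniq n : uniq (words n).
Proof.
elim: n => //= n IH; apply: allpairs_uniq => //; first exact: undup_uniq.
by move=> [a b] [c d] _ _ /= [-> ->].
Qed.

Lemma sum_words1 (V : zmodType) n u (F : seq X -> V) : size u = n ->
  (forall w, size w = n -> w != u -> F w = 0) -> \sum_(w <- words n) F w = F u.
Proof.
move=> su F0; rewrite (bigD1_seq u) ?words_uniq ?mem_words ?su //=.
rewrite big_seq_cond big1 ?addr0 // => w /andP[]; rewrite mem_words => /eqP.
exact: F0.
Qed.

(** Each basis term is recovered from exactly one slice, that of the prefix of length n of its left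
    factor. *)
Lemma lslice_sum n s : supported (fun t => n <= size t.1.1)%N s ->
  s = \sum_(u <- words n) lmul u (lslice u s).
Proof.
move=> Hs; apply: (malg_sum_linear (f := fun u => lmul u \o lslice u) Hs) => t le_n.
rewrite (sum_words1 (u := take n t.1.1)) ?size_takel //=; last first.
  move=> u <- ne; rewrite /lslice lextU.
by rewrite eq_sym (negPf ne) linear0.
rewrite /lslice lextU size_takel // eqxx /lmul lextU /= cat_take_drop.
by case: t le_n => [[]].
Qed.

Lemma rslice_sum n s : supported (fun t => n <= size t.2)%N s ->
  s = \sum_(v <- words n) rmul v (rslice v s).
Proof.
move=> Hs; apply: (malg_sum_linear (f := fun v => rmul v \o rslice v) Hs) => t le_n.
have sd : size (drop (size t.2 - n) t.2) = n by rewrite size_drop subKn.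
rewrite (sum_words1 (u := drop (size t.2 - n) t.2)) //=; last first.
  move=> v sv ne; rewrite /rslice lextU sv.
  by rewrite eq_sym (negPf ne) linear0.
rewrite /rslice lextU sd eqxx /rmul lextU /= cat_take_drop.
by case: t le_n sd => [[]].
Qed.

(** Left multiplication by the degree-n component of f. Over a finite alphabet this component is a
    finite sum of monomials, so the result has finite support. *)
Definition lmulF n (f : seq X -> rat) s : RM :=
  \sum_(u <- words n) f u *: lmul u s.
Definition rmulF n (f : seq X -> rat) s : RM :=
  \sum_(v <- words n) f v *: rmul v s.

Lemma der_lmulF n f s w :
  der w (lmulF n f s) = if (n <= size w)%N then f (take n w) * der (drop n w) s else 0.
Proof.
rewrite /lmulF linear_sum /=.
under eq_bigr => u _ do rewrite linearZ /= der_lmul.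
case: leqP => le_n.
  have st : size (take n w) = n by rewrite size_takel.
  rewrite (sum_words1 st) ?st ?eqxx // => u -> ne.
  by rewrite eq_sym (negPf ne) scaler0.
rewrite big_seq big1 // => u; rewrite mem_words => /eqP su.
case: eqP => [/(congr1 size)|]; rewrite ?scaler0 // size_take_min su.
by move=> /minn_idPl; rewrite leqNgt le_n.
Qed.

Lemma der_rmulF n f s w :
  der w (rmulF n f s) = if (n <= size w)%N
    then der (take (size w - n) w) s * f (drop (size w - n) w) else 0.
Proof.
rewrite /rmulF linear_sum /=.
under eq_bigr => v _ do rewrite linearZ /= der_rmul.
case: leqP => le_n.
  have sd : size (drop (size w - n) w) = n by rewrite size_drop subKn.
  rewrite (sum_words1 sd) ?sd ?eqxx 1?mulrC // => v -> ne.
  by rewrite eq_sym (negPf ne) scaler0.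
rewrite big_seq big1 // => v; rewrite mem_words => /eqP sv.
case: eqP => [/(congr1 size)|]; rewrite ?scaler0 // size_drop sv.
(* Here w is shorter than n: truncated subtraction makes the suffix all of w, which is too short to
   equal v. *)
by rewrite (eqP (ltnW le_n : size w - n == 0)%N) subn0 => E; rewrite E ltnn in le_n.
Qed.

Lemma supported_lmulF (P Q : pred term) n f s : supported P s ->
  (forall u t, size u = n -> P t -> Q (u ++ t.1.1, t.1.2, t.2)) -> supported Q (lmulF n f s).
Proof.
move=> Ps PQ; rewrite /lmulF big_seq; apply: supported_sum => u.
rewrite mem_words => /eqP su; apply: supportedZ; apply: supported_lmul Ps _ => t.
exact: PQ.
Qed.

Lemma supported_rmulF (P Q : pred term) n f s : supported P s ->
  (forall v t, size v = n -> P t -> Q (t.1.1, t.1.2, t.2 ++ v)) -> supported Q (rmulF n f s).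
Proof.
move=> Ps PQ; rewrite /rmulF big_seq; apply: supported_sum => u.
rewrite mem_words => /eqP su; apply: supportedZ; apply: supported_rmul Ps _ => t.
exact: PQ.
Qed.

Lemma liftable_lmulF p n f s : liftable p s -> liftable (n + p) (lmulF n f s).
Proof.
move=> H; rewrite /lmulF big_seq; apply: liftable_sum => u.
by rewrite mem_words => /eqP <-; apply/liftableZ/liftable_lmul.
Qed.

(* The lift of d_A(r) r' - r d_A(r') is d_K(r) r' - r d_K(r'). *)
Lemma liftable_commutator a b s1 s2 :
  supported (fun t => rdeg t == a) s1 -> supported (fun t => rdeg t == b) s2 ->
  liftable (a + b) (lmulF a (fun w => der w s1) s2 - rmulF b (fun w => der w s2) s1).
Proof.
(* [r n] is the degree-n component of d_K(s1) s2 - s1 d_K(s2): as s2 has degree b and s1 degree a,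
   the scalar series enter through degrees n - b and n - a. *)
move=> h1 h2; pose r n := if (a + b <= n)%N then
  lmulF (n - b) (fun w => der w s1) s2 - rmulF (n - a) (fun w => der w s2) s1 else 0.
have gr : graded r.
  move=> n; rewrite /r; case: leqP => le_n; last exact: supported0.
  apply: supportedB; [apply: supported_lmulF h2 _ | apply: supported_rmulF h1 _];
  move=> u [[? ?] ?]; rewrite /rdeg /= size_cat; lia.
exists r; split=> // [n lt_n|w|]; first by rewrite /r leqNgt lt_n.
  rewrite (dserE (N := (size w).+1)) //.
  pose G i : rat := der (take i w) s1 * der (drop i w) s2.
  rewrite -(big_mkord predT (fun n => der w (r n))).
  case: (leqP (a + b) (size w)) => le_w; last first.
    rewrite big_nat big1 // => n /= lt_n; rewrite /r leqNgt.
    by rewrite (leq_trans lt_n le_w) linear0.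
  rewrite (big_cat_nat (n := (a + b)%N)) //=; last by lia.
  rewrite [X in X + _]big_nat big1 ?add0r; last first.
    by move=> n /= lt_n; rewrite /r leqNgt lt_n linear0.
  (* [G i] is the contribution to d_K(s1) d_K(s2) of cutting w at i. Both sums run over the cuts
     from a to [size w - b], in opposite orders, hence the reversal below. *)
  transitivity (\sum_(a + b <= n < (size w).+1) (G (n - b)%N - G (a + size w - n)%N)).
    rewrite !big_nat; apply: eq_bigr => n /andP[le_n lt_n].
    have lE := der_lmulF (n - b) (fun w => der w s1) s2 w.
    have rE := der_rmulF (n - a) (fun w => der w s2) s1 w.
    rewrite /r le_n derB; etransitivity; first exact: (congr2 (fun i j => i - j) lE rE).
    rewrite !ifT; try lia.
    by rewrite /G (_ : a + size w - n = size w - (n - a))%N //; lia.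
  rewrite sumrB [X in _ - X]big_nat_rev /= [X in _ - X]big_nat.
  rewrite [X in X - _]big_nat; apply/eqP; rewrite subr_eq0; apply/eqP.
  by apply: eq_bigr => n /andP[le_n lt_n]; congr (G _); lia.
by rewrite /r leqnn addnK addKn.
Qed.

Lemma lmulFB n f s1 s2 : lmulF n f (s1 - s2) = lmulF n f s1 - lmulF n f s2.
Proof. by rewrite /lmulF -sumrB; apply: eq_bigr => u _; rewrite (linearB (lmul u)) scalerBr. Qed.

(** The closure under pointwise equality stands in for functional extensionality, since [tens]
    determines f only pointwise. *)
Lemma tens_ind (a b : nat) (U W P : (seq X -> rat) -> Prop) :
  (forall f g, (forall x, f x = g x) -> P f -> P g) -> P (fun _ => 0) ->
  (forall c f g, P f -> P g -> P (fun x => c * f x + g x)) ->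
  (forall g h, U g -> W h -> P (tensF a b g h)) ->
  forall f, tens a b U W f -> P f.
Proof.
move=> Pext P0 Plin Pbase f [r [UW fE]].
apply: (Pext (fun x => \sum_(i <- r) i.1.1 * tensF a b i.1.2 i.2 x)) => [x|].
  by rewrite fE.
elim: r UW {fE} => [|t r IH] UW; first by apply: (Pext (fun _ => 0)) => // x; rewrite big_nil.
have [Ut Wt] := List.Forall_inv UW; have UW' := List.Forall_inv_tail UW.
apply: (Pext (fun x => t.1.1 * tensF a b t.1.2 t.2 x +
                       \sum_(i <- r) i.1.1 * tensF a b i.1.2 i.2 x)) => [x|].
  by rewrite big_cons.
by apply: Plin; [apply: Pbase | apply: IH].
Qed.

Definition realized (C : pred term) n (f : seq X -> rat) :=
  exists2 s, supported C s & forall w, size w = n -> der w s = f w.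

Lemma tens_realized C n a b U W f :
  (forall g h, U g -> W h -> realized C n (tensF a b g h)) ->
  tens a b U W f -> realized C n f.
Proof.
move=> base; apply: (tens_ind (P := realized C n)) => // [f1 f2 E [s Cs sE]||c f1 f2].
- by exists s => // w sw; rewrite sE ?E.
- by exists 0; [apply: supported0 | move=> w _; rewrite linear0].
move=> [s1 C1 E1] [s2 C2 E2]; exists (c *: s1 + s2).
  by apply: supportedD => //; apply: supportedZ.
by move=> w sw; rewrite linearP /= E1 ?E2.
Qed.

(** Terms of R_2 have empty outer words. Lifting the factor in d_A(R_2) to R_2 and multiplying back
    the outer factors puts every relator at position i exactly. *)
Lemma relation_realized n i f : (i + 2 <= n)%N ->
  tens i (n - i) (homF i) (tens 2 (n - i - 2) (in_dA y 2) (homF (n - i - 2))) f ->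
  realized (fun t => (size t.1.1 == i) && (rdeg t == n)) n f.
Proof.
move=> le_i; apply: tens_realized => u g _ gT.
have [s Cs sE] : realized (fun t => (size t.1.1 == 0) && (rdeg t == n - i))%N (n - i) g.
  apply: tens_realized gT => g0 h [_ [s0 [/homR_supported Hs0 s0E]]] _.
  exists (rmulF (n - i - 2) h (mkmalg s0)).
    apply: supported_rmulF Hs0 _ => v [[a q] z] sv; rewrite /rdeg /= size_cat; lia.
  move=> w sw; rewrite der_rmulF /tensF (_ : 2 + (n - i - 2) = n - i)%N; last by lia.
  rewrite sw eqxx leq_subr subKn -?s0E //; last by lia.
  by rewrite size_takel ?sw //; lia.
exists (lmulF i u s).
  apply: supported_lmulF Cs _ => v [[a q] z] sv; rewrite /rdeg /= size_cat; lia.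
move=> w sw; rewrite der_lmulF /tensF subnKC ?sw ?eqxx; last by lia.
rewrite ifT ?sE ?size_drop ?sw //; lia.
Qed.

Lemma forall_map (T : eqType) (U : Type) (P : U -> Prop) (r : seq T) (f : T -> U) :
  (forall i, i \in r -> P (f i)) -> List.Forall P [seq f i | i <- r].
Proof.
elim: r => [|i r IH] H /=; first exact: List.Forall_nil.
apply: List.Forall_cons; first by apply: H; rewrite mem_head.
by apply: IH => j jr; apply: H; rewrite in_cons jr orbT.
Qed.

Definition monomial u : seq X -> rat := fun w => (w == u)%:R.

Lemma homF_monomial u : homF (size u) (monomial u).
Proof. by move=> w; rewrite /monomial; case: (w =P u) => [->|]; rewrite ?eqxx. Qed.

(* The quadratic part of y_q. *)
Definition lowest (q : Qi) : seq X -> rat := fun w => if size w == 2 then y q w else 0.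

Lemma apply_term1 q w : apply_term y ([::], q, [::]) w = y q w.
Proof.
by rewrite /apply_term /= subn0 take0 drop_size !eqxx drop0 take_size.
Qed.

Lemma in_dA_lowest q : in_dA y 2 (lowest q).
Proof.
split=> [w|]; first by rewrite /lowest => /negPf ->.
exists (malg_val << ([::], q, [::]) >>); split; first exact/homRP/supportedU.
move=> w sw; rewrite dKhomE (_ : mkmalg _ = << ([::], q, [::]) >>); last exact/malgP.
by rewrite /der lextU apply_term1 /lowest sw.
Qed.

(** For n = 2 the only condition is i = 0, with outer factors in X~^0; tensoring with the empty
    monomial on both sides meets it. *)
Lemma Kz2_lowest q : Kz y 2 (lowest q).
Proof.
have [hom2 _] := in_dA_lowest q; have hom0 := homF_monomial (u := [::]).
split=> // -[|i]; last by rewrite addn2.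
move=> _; exists [:: (1, monomial [::], lowest q)]; split=> [|x].
  apply: List.Forall_cons => //; split; first exact: hom0.
  exists [:: (1, lowest q, monomial [::])]; split=> [|x].
    by apply: List.Forall_cons => //; split; [apply: in_dA_lowest | exact: hom0].
  rewrite big_seq1 mul1r /tensF /=; case: eqP => [sx|/eqP /hom2 //].
  by rewrite take_oversize ?drop_oversize ?sx // /monomial mulr1.
rewrite big_seq1 mul1r /tensF /=; case: eqP => [sx|/eqP /hom2 //].
by rewrite take0 drop0 /monomial mul1r.
Qed.

Lemma Kz1 f : homF 1 f -> Kz y 1 f.
Proof. by move=> f1; split=> // i; rewrite addn2. Qed.

Definition trunc n (f : seq X -> rat) : seq X -> rat := fun w => if size w == n then f w else 0.

Lemma homF_trunc n f : homF n (trunc n f).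
Proof. by move=> w /negPf ne; rewrite /trunc ne. Qed.

Lemma in_dA_der p s : supported (fun t => rdeg t == p) s ->
  in_dA y p (trunc p (fun w => der w s)).
Proof.
move=> Hs; split; first exact: homF_trunc.
by exists (malg_val s); split=> [|w sw]; [apply/homRP | rewrite /trunc sw eqxx].
Qed.

(** * Syzygies of a Koszul algebra *)

Hypothesis hkoszul : Koszul y.
Hypotheses (hsyz2 : piSyz_surj y 2) (hsyz3 : piSyz_surj y 3).

(* f is the image of an element whose left factors all have length k + 1 and which
   can be traded, modulo liftable syzygies, for one with shorter left factors. *)
Definition splits d k f := exists top low : RM,
  [/\ supported (fun t => (size t.1.1 == k.+1) && (rdeg t == d)) top,
      supported (fun t => (size t.1.1 <= k)%N && (rdeg t == d)) low,
      liftable d (top - low) & forall w, size w = d -> der w top = f w].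

Lemma tens_splits d k a b U W f :
  (forall g h, U g -> W h -> splits d k (tensF a b g h)) -> tens a b U W f -> splits d k f.
Proof.
move=> base; apply: (tens_ind (P := splits d k)) => // [f1 f2 E||c f1 f2].
- by move=> [t [l' [? ? ? tE]]]; exists t, l'; split=> // w sw; rewrite tE ?E.
- exists 0, 0; split; try exact: supported0; first by rewrite subr0; apply: liftable0.
  by move=> w _; rewrite linear0.
move=> [t1 [l1 [st1 sl1 L1 E1]]] [t2 [l2 [st2 sl2 L2 E2]]].
exists (c *: t1 + t2), (c *: l1 + l2); split.
- by apply: supportedD => //; apply: supportedZ.
- by apply: supportedD => //; apply: supportedZ.
- rewrite (_ : _ - _ = c *: (t1 - l1) + (t2 - l2)); first exact: liftable_lin.
  by rewrite scalerBr opprD addrACA.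
by move=> w sw; rewrite linearP /= E1 ?E2.
Qed.

Lemma koszul_splits k f : Kpos y k.+3 2 f -> Kneg y k.+3 1 f -> splits k.+3 k f.
Proof.
move=> fpos fneg; have [E _] := hkoszul (isT : 0 < 2)%N (isT : 2 < k.+3)%N f.
have [g [h [gK hK fE]]] := E (conj fpos fneg).
suff [Sg Sh] : splits k.+3 k g /\ splits k.+3 k h.
  have [t1 [l1 [st1 sl1 L1 E1]]] := Sg; have [t2 [l2 [st2 sl2 L2 E2]]] := Sh.
  exists (t1 + t2), (l1 + l2); split; try exact: supportedD.
    by rewrite opprD addrACA; apply: liftableD.
  by move=> w sw; rewrite linearD /= E1 ?E2.
have d3 : (k.+3 - 3 = k)%N by lia.
have d2 : (k.+3 - 2 = k.+1)%N by lia.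
split.
  (* The summand in V^k K_3: an element of K_3 lies in both V S and S V, so it has preimages with
     left factors of length 1 and of length 0. Their difference is a syzygy of degree 3, which
     lifts. *)
  move: gK; rewrite /Kpos d3; apply: tens_splits => u ka _ [_ kK].
  have [al Ca alE] := relation_realized (isT : 1 + 2 <= 3)%N (kK 1%N isT).
  have [be Cb beE] := relation_realized (isT : 0 + 2 <= 3)%N (kK 0%N isT).
  exists (lmulF k u al), (lmulF k u be); split.
  - apply: supported_lmulF Ca _ => v [[a q] z] sv; rewrite /rdeg /= size_cat; lia.
  - apply: supported_lmulF Cb _ => v [[a q] z] sv; rewrite /rdeg /= size_cat; lia.
  - rewrite -lmulFB -(addn3 k); apply: liftable_lmulF; apply: piSyz_liftable => //.
      by apply: supportedB; [apply: supported_sub Ca | apply: supported_sub Cb] => t /andP[].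
    by move=> w sw; rewrite linearB /= alE // beE // subrr.
  move=> w sw; rewrite der_lmulF /tensF addn3 sw eqxx ifT; last by lia.
  by rewrite alE // size_drop sw; lia.
(* The summand in I_{k+1} S: with preimages B of b and T of [si], the product of b and [si] is the
   image of both b T and B [si], which differ by a commutator. Left factors in B [si] come from
   R_{k+1}, so they have length below k. *)
move: hK; rewrite /Kneg d2; apply: tens_splits => b si [_ [B [/homR_supported HB BE]]] [_ sK].
have [T CT TE] := relation_realized (isT : 0 + 2 <= 2)%N (sK 0%N isT).
exists (lmulF k.+1 (fun w => der w (mkmalg B)) T), (rmulF 2 (fun w => der w T) (mkmalg B)).
split.
- apply: supported_lmulF CT _ => v [[a q] z] sv; rewrite /rdeg /= size_cat; lia.
- apply: supported_rmulF HB _ => v [[a q] z] sv; rewrite /rdeg /= size_cat; lia.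
- rewrite -(addn2 k.+1); apply: liftable_commutator => //.
  by apply: supported_sub CT => t /andP[].
move=> w sw; rewrite der_lmulF /tensF addn2 sw eqxx ifT; last by lia.
rewrite TE ?size_drop ?sw ?subSS; last by lia.
by rewrite -dKhomE BE // size_takel ?sw //; lia.
Qed.

(** In degree k + 3 a left factor of length k + 1 leaves an empty right factor, so each term maps to
    a monomial times the quadratic part of a relator, in V^{k+1} S. *)
Lemma Kpos_der k x : supported (fun t => (size t.1.1 == k.+1) && (rdeg t == k.+3)) x ->
  Kpos y k.+3 2 (trunc k.+3 (fun w => der w x)).
Proof.
move=> Cx; rewrite /Kpos (_ : k.+3 - 2 = k.+1)%N; last by lia.
exists [seq (x@_t, monomial t.1.1, lowest t.1.2) | t <- msupp x]; split.
  apply: forall_map => t; rewrite -mcoeff_neq0 => /Cx /andP[/eqP <- _] /=.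
  by split; [apply: homF_monomial | apply: Kz2_lowest].
move=> w; rewrite big_map /trunc /tensF addn2 /=; case: eqP => sw; last first.
  by rewrite big1 // => t _; rewrite mulr0.
rewrite /der /lext !big_seq; apply: eq_bigr => -[[u q] v].
rewrite -mcoeff_neq0 => /Cx /= /andP[/eqP su]; rewrite /rdeg /= => /eqP dv.
have -> : v = [::] by apply: size0nil; lia.
rewrite -{2}[u]cats0 apply_term_catl su /monomial /lowest size_drop sw.
rewrite (_ : k.+3 - k.+1 = 2)%N; last by lia.
by case: eqP => _; rewrite ?mul0r // apply_term1 mul1r.
Qed.

(** By degree, terms of [sk] have right factors of length n and those of [s0] longer ones.
    Cancellation in the syzygy s makes the image of the v-slice of [sk] minus the sum over letters x
    of the images of the xv-slices of [s0], each followed by x; this lies in I_{k+2} V. *)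
Lemma Kneg_der k n s sk s0 v : size v = n -> s = sk + s0 ->
  supported (fun t => (size t.1.1 == k.+1) && (rdeg t == k.+3 + n))%N sk ->
  supported (fun t => (size t.1.1 <= k)%N && (rdeg t == k.+3 + n))%N s0 ->
  (forall w, size w = (k.+3 + n)%N -> der w s = 0) ->
  Kneg y k.+3 1 (trunc k.+3 (fun w => der w (rslice v sk))).
Proof.
move=> sv sE Csk Cs0 sK; rewrite /Kneg (_ : k.+3 - 1 = k.+2)%N; last by lia.
exists [seq (-1, trunc k.+2 (fun w => der w (rslice (x :: v) s0)), monomial [:: x])
       | x <- undup l]; split.
  apply: forall_map => x _; split; last exact/Kz1/(homF_monomial (u := [:: x])).
  apply/in_dA_der/(supported_rslice Cs0) => -[[a q] z] /=.
  rewrite /rdeg /= size_cat /=; lia.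
move=> w; rewrite big_map /tensF addn1 /trunc /=; case: eqP => sw; last first.
  by rewrite big1 // => x _; rewrite mulr0.
case/lastP: w sw => // w x; rewrite size_rcons => -[sw].
rewrite (bigD1_seq x) ?undup_uniq ?mem_undup ?hl //= big1 ?addr0; last first.
  move=> z ne; rewrite -cats1 drop_size_cat // /monomial eqseq_cons andbT.
  by rewrite [x == z]eq_sym (negPf ne) !mulr0.
rewrite -cats1 drop_size_cat // take_size_cat // /monomial eqxx mulr1 sw eqxx mulN1r.
rewrite -!der_rslice; last 2 first.
- by apply: supported_sub Cs0 => -[[a q] z] /=; rewrite /rdeg /= sv; lia.
- by apply: supported_sub Csk => -[[a q] z] /=; rewrite /rdeg /= sv; lia.
rewrite -catA /=; apply/eqP; rewrite -addr_eq0 -linearD -sE; apply/eqP/sK.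
by rewrite size_cat /= sw sv; lia.
Qed.

(** * Shortening left factors by induction *)

Definition reducible p k s := exists2 s' : RM,
  supported (fun t => (size t.1.1 <= k)%N && (rdeg t == p)) s' & liftable p (s - s').

Lemma reducible_sum p k (I : eqType) (r : seq I) (F : I -> RM) :
  (forall i, i \in r -> reducible p k (F i)) -> reducible p k (\sum_(i <- r) F i).
Proof.
move=> H; rewrite big_seq; elim/big_ind: _ => //.
  by exists 0; [apply: supported0 | rewrite subr0; apply: liftable0].
move=> s1 s2 [t1 C1 L1] [t2 C2 L2]; exists (t1 + t2); first exact: supportedD.
by rewrite opprD addrACA; apply: liftableD.
Qed.

(** Right factors are empty here, so slicing off the left factors leaves syzygies in R_2, which lift
    by [hsyz2]. *)
Lemma liftable_left_length k d x : (d = k + 2)%N ->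
  supported (fun t => (size t.1.1 == k) && (rdeg t == d)) x ->
  (forall w, size w = d -> der w x = 0) -> liftable d x.
Proof.
move=> -> Cx xK; rewrite (@lslice_sum k x); last first.
  by apply: supported_sub Cx => t /andP[/eqP ->].
rewrite big_seq; apply: liftable_sum => u; rewrite mem_words => /eqP su.
rewrite -su; apply: liftable_lmul; apply: piSyz_liftable => //.
  apply: supported_lslice Cx _ => -[[a q] v]; rewrite /rdeg /= size_cat; lia.
move=> w sw; rewrite -der_lslice ?xK ?size_cat ?su ?sw //.
by apply: supported_sub Cx => t /andP[/eqP ->].
Qed.

(** The mirror case, with empty left factors; it starts the induction on the length of left
    factors. *)
Lemma liftable_right_length n s :
  supported (fun t => (size t.2 == n) && (rdeg t == n + 2))%N s ->
  (forall w, size w = (n + 2)%N -> der w s = 0) -> liftable (n + 2) s.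
Proof.
move=> Cs sK; rewrite (@rslice_sum n s); last first.
  by apply: supported_sub Cs => t /andP[/eqP ->].
rewrite big_seq; apply: liftable_sum => v; rewrite mem_words => /eqP sv.
rewrite -sv addnC; apply: liftable_rmul; apply: piSyz_liftable => //.
  apply: supported_rslice Cs _ => -[[a q] z]; rewrite /rdeg /= size_cat; lia.
move=> w sw; rewrite -der_rslice ?sK ?size_cat ?sv ?sw //; first by rewrite addnC.
by apply: supported_sub Cs => t /andP[/eqP ->].
Qed.

Definition restrict (P : pred term) s : RM :=
  [malg t in msupp s => if P t then s@_t else 0].

Lemma mcoeff_restrict P s t : (restrict P s)@_t = if P t then s@_t else 0.
Proof.
rewrite /restrict mcoeffE; case: ifP => // /negbT /mcoeff_outdom ->.
by case: ifP.
Qed.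

Lemma liftable_bounded k p s :
  supported (fun t => (size t.1.1 <= k)%N && (rdeg t == p)) s ->
  (forall w, size w = p -> der w s = 0) -> liftable p s.
Proof.
elim: k s => [|k IH] s Cs sK.
  case: (ltnP p 2) => p2.
    rewrite (_ : s = 0); first exact: liftable0.
    apply: supported_eq0; apply: supported_sub Cs => t /andP[_]; rewrite /rdeg /=; lia.
  rewrite -(subnK p2); apply: liftable_right_length; rewrite ?subnK //.
  by apply: supported_sub Cs => -[[a q] v]; rewrite /rdeg /=; lia.
(* When p <= k + 2, left factors have length at most p - 2 <= k already. *)
case: (ltnP p k.+3) => pk.
  apply: IH => //; apply: supported_sub Cs => -[[a q] v]; rewrite /rdeg /=; lia.
(* n is the common length of the right factors in the part [sk] with the longest left factors. *)
pose n := (p - k.+3)%N; have pE : p = (k.+3 + n)%N by rewrite /n; lia.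
pose sk := restrict (fun t => size t.1.1 == k.+1) s; pose s0 := s - sk.
have sE : s = sk + s0 by rewrite addrC subrK.
have Csk : supported (fun t => (size t.1.1 == k.+1) && (rdeg t == p)) sk.
  by move=> t; rewrite mcoeff_restrict; case: ifP => [_ /Cs /andP[]|_]; rewrite ?eqxx.
have Cs0 : supported (fun t => (size t.1.1 <= k)%N && (rdeg t == p)) s0.
  move=> t; rewrite mcoeffB mcoeff_restrict; case: ifP => [|ne]; first by rewrite subrr eqxx.
  by rewrite subr0 => /Cs; rewrite leq_eqVlt ne.
(* Replacing [sk] by a shorter [s'] changes s by a liftable syzygy, so [s' + s0] is again a syzygy
   and the induction hypothesis applies to it. *)
suff [s' Cs' Ls'] : reducible p k sk.
  have Ls : liftable p (s - (s' + s0)) by rewrite {1}sE opprD addrACA subrr addr0.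
  rewrite -[s](subrK (s' + s0)); apply: liftableD => //; apply: IH; first exact: supportedD.
  by move=> w sw; rewrite -[s' + s0](subKr s) linearB /= sK // (liftable_der Ls) ?subrr.
rewrite (@rslice_sum n sk); last first.
  by apply: supported_sub Csk => -[[a q] v]; rewrite /rdeg /=; lia.
apply: reducible_sum => v; rewrite mem_words => /eqP sv; set x := rslice v sk.
have Cx : supported (fun t => (size t.1.1 == k.+1) && (rdeg t == k.+3)) x.
  apply: supported_rslice Csk _ => -[[a q] z]; rewrite /rdeg /= size_cat; lia.
have [|top [low [Ctop Clow L topE]]] := koszul_splits (Kpos_der Cx).
  by rewrite pE in Csk Cs0 sK; apply: Kneg_der sE Csk Cs0 sK.
exists (rmul v low).
  apply: supported_rmul Clow _ => -[[a q] z]; rewrite /rdeg /= size_cat; lia.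
rewrite -linearB pE -sv; apply: liftable_rmul.
(* Pass through [top]: it has the same image as x and, like x, left factors of length k + 1, so
   [x - top] reduces to syzygies of degree 2. *)
rewrite -(subrKA top) addrC; apply: liftableD; first exact: L.
apply: (@liftable_left_length k.+1); [by lia | exact: supportedB |].
by move=> w sw; rewrite linearB /= topE // /trunc sw eqxx subrr.
Qed.

Lemma koszul_quadratic : quadratic y.
Proof.
apply: quadratic_of_liftable => p s Cs sK; apply: (@liftable_bounded p) => //.
by apply: supported_sub Cs => -[[a q] v]; rewrite /rdeg /=; lia.
Qed.

End FiniteAlphabet.
End Bimodule.

Theorem theorem3p4 (X Qi : choiceType) (y : Qi -> seq X -> rat)
    (hyF : forall q, Fser (y q))
    (hy2 : forall q w, (size w < 2)%N -> y q w = 0%R) :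
  ((forall p : nat, (2 <= p)%N -> piSyz_surj y p) -> quadratic y) /\
  ((exists s : seq X, forall x, x \in s) -> Koszul y ->
     piSyz_surj y 2 -> piSyz_surj y 3 -> quadratic y).
Proof.
split=> [sur|[l hl] ky s2 s3]; last exact: (koszul_quadratic hy2 hl ky s2 s3).
apply: (quadratic_of_liftable hy2) => p s Cs sK.
(* Below degree 2 the bimodule is zero, so surjectivity is only called on for p >= 2. *)
have [lt_p|le_p] := ltnP p 2; last exact: (piSyz_liftable (sur p le_p)).
rewrite (_ : s = 0); first exact: liftable0.
by apply: supported_eq0; apply: supported_sub Cs => t; rewrite /rdeg /=; lia.
Qed.
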